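(* Let $C$ be a bivariate copula, let $f,g:[0,1]\to\mathbb{R}$ satisfy conditions (G1), (G2), (G3), and let $\phi\in\mathcal{F}_1$, $\psi\in\mathcal{F}_2$ (all recalled in the context). Let $\overline{C}_{f,g}^{\,\sigma}=\lim_{n\to\infty}(T^\sigma_{f,g})^{(n)}(C^\sigma)$ and $\overline{C}_{\phi,\psi}=\lim_{n\to\infty}T_{\phi,\psi}^{(n)}(C)$ be the (pointwise) limit copulas. (a) If $C$ is PQD, or equivalently $C^\sigma$ is NQD, then $\overline{C}_{f,g}^{\,\sigma}$ is NQD. (b) If either $f(x)\ne0$ for all $x\in(0,1)$ or $g(x)\neq 0$ for all $x\in(0,1)$, then $\overline{C}_{f,g}^{\,\sigma}$ is NQD for any copula $C$. (c) If $C$ is PQD, then $\overline{C}_{\phi,\psi}$ is PQD. (d) If either $\phi(x)\ne x$ for all $x\in(0,1)$ or $\psi(x)\ne x$ for all $x\in(0,1)$, then $\overline{C}_{\phi,\psi}$ is PQD for any copula $C$.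
   Context: A copula $D$ is PQD (positively quadrant dependent) if $D(u,v)\ge uv$ for all $u,v\in[0,1]$, and NQD (negatively quadrant dependent) if $D(u,v)\le uv$ for all $u,v\in[0,1]$. The flip of $C$ is $C^\sigma(u,v)=u-C(u,1-v)$. For $f,g:[0,1]\to\mathbb{R}$ put $f^*(u)=f(u)/u$, $g^*(v)=g(v)/v$, $\widehat f(u)=u+f(u)$, $\widehat g(v)=v+g(v)$. Conditions: (G1) $f(0)=g(0)=0$, $f(1)=g(1)=0$, $f^*(1)=g^*(1)=0$; (G2) $\widehat f,\widehat g$ are nondecreasing on $[0,1]$; (G3) $f^*,g^*$ are nonincreasing on $(0,1]$. The reflected maxmin transformation on copulas is $$T^\sigma_{f,g}(D)(u,v)=uv\,\frac{D(\widehat f(u),\widehat g(v))}{\widehat f(u)\widehat g(v)}\max\{0,1-f^*(u)g^*(v)\}$$ (read as $0$ when $u=0$ or $v=0$), and $(T^\sigma_{f,g})^{(n)}$ is its $n$-th iterate. $\mathcal{F}_1$ is the class of nondecreasing $\phi:[0,1]\to[0,1]$ with $\phi(0)=0,\phi(1)=1$ such that $\phi^*(u):=u/\phi(u)$ is nondecreasing on $(0,1]$. $\mathcal{F}_2$ is the class of nondecreasing $\psi:[0,1]\to[0,1]$ with $\psi(0)=0,\psi(1)=1$ such that $\psi_*$, given by $\psi_*(v)=\frac{v-\psi(v)}{1-\psi(v)}$ for $v\in[0,1)$ and $\psi_*(1)=1$, is nondecreasing. The maxmin transformation on copulas is $$T_{\phi,\psi}(C)(u,v)=u+(C(\phi(u),\psi(v))-\phi(u))\max\{0,\phi^*(u)-\psi_*(v)\}$$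 (read as $0$ when $u=0$), and $T_{\phi,\psi}^{(n)}$ is its $n$-th iterate. The paper establishes that both pointwise limits always exist. *)

(* Defs.v *)
(* Functions on [0, 1] and on [0, 1]^2 are total
   functions on R; every condition below is restricted to the unit interval and
   only the values there matter. *)
From mathcomp Require Import all_boot all_order all_algebra.
From mathcomp Require Import all_classical all_reals all_analysis.

Set Implicit Arguments.
Unset Strict Implicit.
Unset Printing Implicit Defensive.

Import Order.TTheory GRing.Theory Num.Theory.
Import numFieldNormedType.Exports.

Local Open Scope ring_scope.

Section Copulas.
Context {R : realType}.
Implicit Types (C D : R -> R -> R) (f g phi psi : R -> R).

Record copula C : Prop := Copula {
  copula_range : {in `[0, 1] &, forall u v, C u v \in `[0, 1]};
  copula_u0 : {in `[0, 1], forall u, C u 0 = 0};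
  copula_0v : {in `[0, 1], forall v, C 0 v = 0};
  copula_u1 : {in `[0, 1], forall u, C u 1 = u};
  copula_1v : {in `[0, 1], forall v, C 1 v = v};
  copula_2incr : forall u1 u2 v1 v2,
    0 <= u1 -> u1 <= u2 -> u2 <= 1 -> 0 <= v1 -> v1 <= v2 -> v2 <= 1 ->
    0 <= C u2 v2 - C u2 v1 - C u1 v2 + C u1 v1 }.

Definition PQD D := {in `[0, 1] &, forall u v, u * v <= D u v}.

Definition NQD D := {in `[0, 1] &, forall u v, D u v <= u * v}.

Definition flip C : R -> R -> R := fun u v => u - C u (1 - v).

Definition fstar f (u : R) : R := f u / u.

Definition fhat f (u : R) : R := u + f u.

Definition G1 f g : Prop :=
  [/\ f 0 = 0 /\ g 0 = 0, f 1 = 0 /\ g 1 = 0 & fstar f 1 = 0 /\ fstar g 1 = 0].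

Definition G2 f g : Prop :=
  {in `[0, 1] &, {homo fhat f : x y / x <= y}} /\
  {in `[0, 1] &, {homo fhat g : x y / x <= y}}.

Definition G3 f g : Prop :=
  {in `]0, 1] &, {homo fstar f : x y /~ x <= y}} /\
  {in `]0, 1] &, {homo fstar g : x y /~ x <= y}}.

Definition Tsigma f g D : R -> R -> R := fun u v =>
  if (u == 0) || (v == 0) then 0
  else u * v * (D (fhat f u) (fhat g v) / (fhat f u * fhat g v))
         * Num.max 0 (1 - fstar f u * fstar g v).

Definition phistar phi (u : R) : R := u / phi u.

Definition psistar psi (v : R) : R :=
  if v == 1 then 1 else (v - psi v) / (1 - psi v).

(* The condition [0 < phi u] in [F1] and the condition [psi v < 1] in [F2] say
   that the denominators of [phistar] and [psistar] do not vanish, which the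
   usual definition presupposes; they cannot be dropped since [x / 0 = 0]. *)
Record F1 phi : Prop := MkF1 {
  F1_range : {in `[0, 1], forall u, phi u \in `[0, 1]};
  F1_homo : {in `[0, 1] &, {homo phi : x y / x <= y}};
  F1_0 : phi 0 = 0;
  F1_1 : phi 1 = 1;
  F1_gt0 : {in `]0, 1], forall u, 0 < phi u};
  F1_star : {in `]0, 1] &, {homo phistar phi : x y / x <= y}} }.

Record F2 psi : Prop := MkF2 {
  F2_range : {in `[0, 1], forall v, psi v \in `[0, 1]};
  F2_homo : {in `[0, 1] &, {homo psi : x y / x <= y}};
  F2_0 : psi 0 = 0;
  F2_1 : psi 1 = 1;
  F2_lt1 : {in `[0, 1[, forall v, psi v < 1};
  F2_star : {in `[0, 1] &, {homo psistar psi : x y / x <= y}} }.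

Definition Tmaxmin phi psi C : R -> R -> R := fun u v =>
  if u == 0 then 0
  else u + (C (phi u) (psi v) - phi u)
             * Num.max 0 (phistar phi u - psistar psi v).

Definition iterates_cvg (T : (R -> R -> R) -> (R -> R -> R)) C :=
  {in `[0, 1] &, forall u v, cvgn (fun n => iter n T C u v)}.

(* [limn] returns an arbitrary value on a divergent sequence, so this is the
   pointwise limit only under [iterates_cvg T C]. *)
Definition iterates_lim (T : (R -> R -> R) -> (R -> R -> R)) C : R -> R -> R :=
  fun u v => limn (fun n => iter n T C u v).

End Copulas.

(* Main.v *)
Require Import Defs.
From mathcomp Require Import all_boot all_order all_algebra.
From mathcomp Require Import all_classical all_reals all_analysis.
From mathcomp Require Import ring lra.

Import Order.TTheory GRing.Theory Num.Theory.
Import numFieldNormedType.Exports.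
Local Open Scope ring_scope.

(** For [u, v > 0] put [r_D(u, v) = D(u, v) / (u v)].  In terms of this ratio
    the reflected transformation is a weighted change of variables:
    [r_(T D)(u, v) = r_D(fhat u, ghat v) * m(u, v)] where the damping factor
    [m(u, v) = max(0, 1 - f*(u) g*(v))] lies in [[0, 1]].  Iterating
    ([iter_TsigmaE]), [r_(T^n D)(u, v)] is [r_D] at the [n]-th points of the
    orbits of [u] under [fhat] and of [v] under [ghat], times a product of [n]
    damping factors.  Both orbits are nondecreasing in [(0, 1]] and the products
    decrease, so the iterates converge for every copula [D]
    ([Tsigma_iterates_cvg]).

    If [D] is NQD, then [r_D <= 1], hence every [r_(T^n D) <= 1], and so is the
    limit.  If [f] has no zero in [(0, 1)], the orbit [x_n] of [u] tends to 1: a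
    limit [a < 1] would give [x_(n+1) >= x_n (1 + f*(a))], a geometric growth
    ([orbit_cvg1]).  Since a copula satisfies [D(x, y) <= y], we have
    [r_D(x_n, y_n) <= 1 / x_n], which tends to 1, so the limit is NQD whatever
    [D] is.  The case of [g] is symmetric.

    The maxmin transformation is conjugate to the reflected one: with
    [f(u) = phi(u) - u] and [g(w) = 1 - w - psi(1 - w)], one has
    [flip (T_(phi,psi) C) = Tsigma_(f,g) (flip C)] ([iter_TmaxminE]).  The
    statements on [phi] and [psi] are therefore those on [f] and [g], the flip
    exchanging NQD and PQD. *)

Section MaxminLimits.
Context {R : realType}.
Implicit Types (C D : R -> R -> R) (f g h phi psi : R -> R) (u v x : R).

(** * Copulas and their flips *)

Lemma copula_homo_l D u1 u2 v : copula D ->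
  0 <= u1 -> u1 <= u2 -> u2 <= 1 -> v \in `[0, 1] -> D u1 v <= D u2 v.
Proof.
move=> hD u1ge0 u12 u2le1; rewrite in_itv /= => /andP[v0 v1].
have := copula_2incr hD u1ge0 u12 u2le1 (lexx 0) v0 v1.
rewrite !(copula_u0 hD) ?in_itv /= ?u1ge0 ?u2le1; lra.
Qed.

Lemma copula_homo_r D u v1 v2 : copula D ->
  u \in `[0, 1] -> 0 <= v1 -> v1 <= v2 -> v2 <= 1 -> D u v1 <= D u v2.
Proof.
move=> hD; rewrite in_itv /= => /andP[u0 u1] v1ge0 v12 v2le1.
have := copula_2incr hD (lexx 0) u0 u1 v1ge0 v12 v2le1.
rewrite !(copula_0v hD) ?in_itv /= ?v1ge0 ?v2le1 /=; lra.
Qed.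

Lemma copula_le_l D u v : copula D ->
  u \in `[0, 1] -> v \in `[0, 1] -> D u v <= u.
Proof.
move=> hD uI; rewrite in_itv /= => /andP[v0 v1].
rewrite -[leRHS](copula_u1 hD)//; exact: copula_homo_r.
Qed.

Lemma copula_le_r D u v : copula D ->
  u \in `[0, 1] -> v \in `[0, 1] -> D u v <= v.
Proof.
move=> hD; rewrite in_itv /= => /andP[u0 u1] vI.
rewrite -[leRHS](copula_1v hD)//; exact: copula_homo_l.
Qed.

Lemma onem_itv v : v \in `[0, 1] -> 1 - v \in `[0, 1].
Proof. by rewrite !in_itv /= => /andP[? ?]; apply/andP; split; lra. Qed.

Lemma flip_copula C : copula C -> copula (flip C).
Proof.
move=> hC; have I0 : (0 : R) \in `[0, 1] by rewrite in_itv /= lexx ler01.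
have I1 : (1 : R) \in `[0, 1] by rewrite in_itv /= lexx ler01.
split; rewrite /flip.
- move=> u v uI vI; have v'I := onem_itv _ vI.
  have := copula_range hC uI v'I; have := copula_le_l _ _ _ hC uI v'I.
  by move: uI; rewrite !in_itv /= => /andP[? ?] ? /andP[? ?]; apply/andP; split;
    lra.
- by move=> u uI; rewrite subr0 (copula_u1 hC)// subrr.
- by move=> v vI; rewrite (copula_0v hC) ?subrr//; exact: onem_itv.
- by move=> u uI; rewrite subrr (copula_u0 hC)// subr0.
- by move=> v vI; rewrite (copula_1v hC) ?onem_itv//; lra.
- move=> u1 u2 v1 v2 u1ge0 u12 u2le1 v1ge0 v12 v2le1.
  have w2_ge0 : 0 <= 1 - v2 by lra.
  have w21 : 1 - v2 <= 1 - v1 by lra.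
  have w1_le1 : 1 - v1 <= 1 by lra.
  by have := copula_2incr hC u1ge0 u12 u2le1 w2_ge0 w21 w1_le1; lra.
Qed.

Lemma PQD_flip C : PQD C <-> NQD (flip C).
Proof.
split=> hC u v uI vI; rewrite /flip.
  by have := hC u (1 - v) uI (onem_itv _ vI); lra.
by have := hC u (1 - v) uI (onem_itv _ vI); rewrite /flip subKr; lra.
Qed.

(** * Orbits of one generating function *)

(** The part of (G1), (G2) and (G3) that bears on one of the two functions. *)
Record generator f : Prop := Generator {
  gen0 : f 0 = 0;
  gen1 : f 1 = 0;
  gen_fhat : {in `[0, 1] &, {homo fhat f : x y / x <= y}};
  gen_fstar : {in `]0, 1] &, {homo fstar f : x y /~ x <= y}} }.

Lemma generators f g : G1 f g -> G2 f g -> G3 f g -> generator f /\ generator g.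
Proof. by move=> [[? ?] [? ?] _] [? ?] [? ?]. Qed.

Lemma fstar_ge0 f u : generator f -> u \in `]0, 1] -> 0 <= fstar f u.
Proof.
move=> hf uI; have -> : 0 = fstar f 1 by rewrite /fstar (gen1 _ hf) mul0r.
apply: (gen_fstar _ hf) => //; first by rewrite in_itv /= ltr01 lexx.
by move: uI; rewrite in_itv /= => /andP[].
Qed.

Lemma fhatE f u : u != 0 -> fhat f u = u * (1 + fstar f u).
Proof. by move=> u0; rewrite /fhat /fstar; field. Qed.

Lemma fhat_ge f u : generator f -> u \in `]0, 1] -> u <= fhat f u.
Proof.
move=> hf uI; have := fstar_ge0 _ _ hf uI.
move: uI; rewrite in_itv /= => /andP[u0 _] ?.
by rewrite fhatE ?gt_eqF// ler_pMr// lerDl.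
Qed.

Lemma fhat_itv f u : generator f -> u \in `]0, 1] -> fhat f u \in `]0, 1].
Proof.
move=> hf uI; have u_le := fhat_ge _ _ hf uI.
move: uI; rewrite !in_itv /= => /andP[u0 u1]; rewrite (lt_le_trans u0 u_le)/=.
have -> : 1 = fhat f 1 by rewrite /fhat (gen1 _ hf) addr0.
by apply: (gen_fhat _ hf); rewrite // in_itv /= ?ler01 ?lexx ?(ltW u0).
Qed.

Definition orbit f u n := iter n (fhat f) u.

Lemma orbit_itv f u n : generator f -> u \in `]0, 1] -> orbit f u n \in `]0, 1].
Proof. by move=> hf uI; elim: n => //= n; exact: fhat_itv. Qed.

Lemma orbit_gt0 f u n : generator f -> u \in `]0, 1] -> 0 < orbit f u n.
Proof. by move=> hf /(orbit_itv _ _ n hf); rewrite in_itv => /andP[]. Qed.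

Lemma orbit_le1 f u n : generator f -> u \in `]0, 1] -> orbit f u n <= 1.
Proof. by move=> hf /(orbit_itv _ _ n hf); rewrite in_itv => /andP[]. Qed.

Lemma orbit_itvW f u n : generator f -> u \in `]0, 1] ->
  orbit f u n \in `[0, 1].
Proof.
by move=> hf uI; rewrite in_itv /= ltW ?orbit_gt0 ?orbit_le1.
Qed.

Lemma orbit_nondecreasing f u : generator f -> u \in `]0, 1] ->
  nondecreasing_seq (orbit f u).
Proof.
move=> hf uI; apply/nondecreasing_seqP => n.
exact: fhat_ge (orbit_itv _ _ n hf uI).
Qed.

Lemma orbit_is_cvg f u : generator f -> u \in `]0, 1] -> cvgn (orbit f u).
Proof.
move=> hf uI; apply: nondecreasing_is_cvgn; first exact: orbit_nondecreasing.
by exists 1 => _ [n _ <-]; exact: orbit_le1.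
Qed.

Lemma orbit_le_lim f u n : generator f -> u \in `]0, 1] ->
  orbit f u n <= limn (orbit f u).
Proof.
move=> hf uI; apply: nondecreasing_cvgn_le; first exact: orbit_nondecreasing.
exact: orbit_is_cvg.
Qed.

(** As [fhat f] may jump, a limit of the orbit is not automatically a fixed
    point.  What excludes a limit [a < 1] is the monotonicity of [f*]: each step
    multiplies the orbit by at least [1 + f*(a) > 1], so that every term is at
    most [a / (1 + f*(a))]. *)
Lemma orbit_cvg1 f u : generator f -> {in `]0, 1[, forall x, f x != 0} ->
  u \in `]0, 1] -> (orbit f u @ \oo --> (1 : R))%classic.
Proof.
move=> hf fN0 uI; have cx := orbit_is_cvg _ _ hf uI.
set a := limn (orbit f u).
have a_gt0 : 0 < a.
  exact: lt_le_trans (orbit_gt0 _ _ 0 hf uI) (orbit_le_lim _ _ 0 hf uI).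
have a_le1 : a <= 1.
  by apply: limr_le => //; apply: nearW => n; exact: orbit_le1.
suff -> : (1 : R) = a by [].
apply/eqP; rewrite eq_sym eq_le a_le1 /= leNgt; apply/negP => a_lt1.
have aI : a \in `]0, 1] by rewrite in_itv /= a_gt0.
have c_gt0 : 0 < fstar f a.
  rewrite lt_neqAle fstar_ge0// andbT eq_sym.
  rewrite mulf_neq0 ?invr_eq0 ?(gt_eqF a_gt0)//.
  by apply: fN0; rewrite in_itv /= a_gt0.
have : a <= a / (1 + fstar f a).
  apply: limr_le => //; apply: nearW => n.
  rewrite ler_pdivlMr; last lra.
  apply: le_trans (orbit_le_lim _ _ n.+1 hf uI).
  have xI := orbit_itv _ _ n hf uI; have x_gt0 := orbit_gt0 _ _ n hf uI.
  rewrite /= fhatE ?gt_eqF// ler_pM2l// lerD2l.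
  by apply: (gen_fstar _ hf) => //; exact: orbit_le_lim.
rewrite ler_pdivlMr; last lra.
by rewrite ger_pMr// gerDl leNgt c_gt0.
Qed.

(** * Limits of the reflected maxmin transformation *)

Definition damping f g u v := Num.max 0 (1 - fstar f u * fstar g v).

Lemma damping_ge0 f g u v : 0 <= damping f g u v.
Proof. by rewrite le_max lexx. Qed.

Lemma damping_le1 f g u v : generator f -> generator g ->
  u \in `]0, 1] -> v \in `]0, 1] -> damping f g u v <= 1.
Proof.
move=> hf hg uI vI; rewrite ge_max ler01 /= gerBl.
by rewrite mulr_ge0 ?fstar_ge0.
Qed.

Definition damping_prod f g u v n :=
  \prod_(k < n) damping f g (orbit f u k) (orbit g v k).

Lemma damping_prod_ge0 f g u v n : 0 <= damping_prod f g u v n.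
Proof. by apply: prodr_ge0 => k _; exact: damping_ge0. Qed.

Lemma damping_prod_le1 f g u v n : generator f -> generator g ->
  u \in `]0, 1] -> v \in `]0, 1] -> damping_prod f g u v n <= 1.
Proof.
move=> hf hg uI vI; apply: prodr_ile1 => k _.
by rewrite damping_ge0 damping_le1 ?orbit_itv.
Qed.

Lemma damping_prod_is_cvg f g u v : generator f -> generator g ->
  u \in `]0, 1] -> v \in `]0, 1] -> cvgn (damping_prod f g u v).
Proof.
move=> hf hg uI vI; apply: nonincreasing_is_cvgn; last first.
  by exists 0 => _ [n _ <-]; exact: damping_prod_ge0.
apply/nonincreasing_seqP => n; rewrite /damping_prod big_ord_recr /=.
by rewrite ler_piMr ?damping_prod_ge0 ?damping_le1 ?orbit_itv.
Qed.

Definition orbit_ratio f g D u v n :=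
  D (orbit f u n) (orbit g v n) / (orbit f u n * orbit g v n).

Lemma iter_TsigmaE f g D u v n : generator f -> generator g ->
  u \in `]0, 1] -> v \in `]0, 1] ->
  iter n (Tsigma f g) D u v
  = u * v * (orbit_ratio f g D u v n * damping_prod f g u v n).
Proof.
move=> hf hg; elim: n u v => [|n IHn] u v uI vI.
  rewrite /damping_prod big_ord0 mulr1 /orbit_ratio /=.
  move: uI vI; rewrite !in_itv /= => /andP[u0 _] /andP[v0 _].
  by field; rewrite !gt_eqF.
have orbitS h x k : orbit h x k.+1 = orbit h (fhat h x) k by exact: iterSr.
have [uI' vI'] := (fhat_itv _ _ hf uI, fhat_itv _ _ hg vI).
rewrite iterS /Tsigma -/(Tsigma f g) IHn// /orbit_ratio !orbitS.
rewrite [in RHS]/damping_prod big_ord_recl.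
under [in RHS]eq_bigr => k _ do rewrite lift0 !orbitS.
rewrite -[damping _ _ (orbit f u _) _]/(damping f g u v).
move: uI vI uI' vI'; rewrite !in_itv /=.
move=> /andP[u0 _] /andP[v0 _] /andP[u0' _] /andP[v0' _].
rewrite !gt_eqF//= -/(damping f g u v) -/(damping_prod f g _ _ n).
set r := D _ _ / _; set p := damping_prod _ _ _ _ _; set m := damping _ _ _ _.
by field; rewrite !gt_eqF.
Qed.

(** [Tsigma] vanishes on the axes by convention; for [n = 0] the reason is that
    [D] is a copula. *)
Lemma iter_Tsigma0 f g D u v n : copula D -> u \in `[0, 1] -> v \in `[0, 1] ->
  (u == 0) || (v == 0) -> iter n (Tsigma f g) D u v = 0.
Proof.
move=> hD uI vI uv0; case: n => [|n]; last by rewrite /= /Tsigma uv0.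
case/orP: uv0 => /eqP -> /=; first exact: copula_0v hD _ _.
exact: copula_u0 hD _ _.
Qed.

(** The numerator converges by monotonicity alone: along nondecreasing orbits,
    the values of [D] are nondecreasing, and bounded by 1. *)
Lemma orbit_ratio_is_cvg f g D u v : generator f -> generator g -> copula D ->
  u \in `]0, 1] -> v \in `]0, 1] -> cvgn (orbit_ratio f g D u v).
Proof.
move=> hf hg hD uI vI; apply: is_cvgM; last first.
  apply: is_cvgV; last by apply: is_cvgM; exact: orbit_is_cvg.
  rewrite limM; [|exact: orbit_is_cvg..].
  rewrite mulf_neq0// gt_eqF//.
    exact: lt_le_trans (orbit_gt0 _ _ 0 hf uI) (orbit_le_lim _ _ 0 hf uI).
  exact: lt_le_trans (orbit_gt0 _ _ 0 hg vI) (orbit_le_lim _ _ 0 hg vI).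
apply: nondecreasing_is_cvgn; last first.
  exists 1 => _ [n _ <-]; apply: le_trans (orbit_le1 _ _ n hf uI).
  by apply: copula_le_l; rewrite ?orbit_itvW.
move=> m n mn; apply: (@le_trans _ _ (D (orbit f u n) (orbit g v m))).
  apply: copula_homo_l; rewrite ?orbit_itvW ?orbit_le1//.
    by rewrite ltW ?orbit_gt0.
  exact: orbit_nondecreasing.
apply: copula_homo_r; rewrite ?orbit_itvW ?orbit_le1//.
  by rewrite ltW ?orbit_gt0.
exact: orbit_nondecreasing.
Qed.

Lemma unit_itv_case u : u \in `[0, 1] -> u = 0 \/ u \in `]0, 1].
Proof.
rewrite !in_itv /= => /andP[].
by rewrite le_eqVlt => /predU1P[<-|->]; [left | right].
Qed.

Lemma Tsigma_iterates_cvg f g D : generator f -> generator g -> copula D ->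
  iterates_cvg (Tsigma f g) D.
Proof.
move=> hf hg hD u v uI vI.
have cvg0 : (u == 0) || (v == 0) -> cvgn (fun n => iter n (Tsigma f g) D u v).
  move=> uv0; under eq_fun => n do rewrite iter_Tsigma0//.
  exact: is_cvg_cst.
case: (unit_itv_case _ uI) => [u0|uI']; first by apply: cvg0; rewrite u0 eqxx.
case: (unit_itv_case _ vI) => [v0|vI'].
  by apply: cvg0; rewrite v0 eqxx orbT.
under eq_fun => n do rewrite iter_TsigmaE//.
apply: is_cvgMr; apply: is_cvgM; first exact: orbit_ratio_is_cvg.
exact: damping_prod_is_cvg.
Qed.

(** The damping factors only help: it suffices to bound the ratio of [D] to the
    independence copula asymptotically along the orbits. *)
Lemma Tsigma_lim_NQD f g D : generator f -> generator g -> copula D ->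
  {in `]0, 1] &, forall u v, exists2 b : R^nat, (b @ \oo --> (1 : R))%classic &
     forall n, orbit_ratio f g D u v n <= b n} ->
  NQD (iterates_lim (Tsigma f g) D).
Proof.
move=> hf hg hD hb u v uI vI.
have le0 : (u == 0) || (v == 0) -> iterates_lim (Tsigma f g) D u v <= u * v.
  move=> uv0; rewrite /iterates_lim.
  under eq_fun => n do rewrite iter_Tsigma0//.
  by rewrite lim_cst//; move: uv0 => /orP[] /eqP ->; rewrite (mul0r, mulr0).
case: (unit_itv_case _ uI) => [u0|uI']; first by apply: le0; rewrite u0 eqxx.
case: (unit_itv_case _ vI) => [v0|vI'].
  by apply: le0; rewrite v0 eqxx orbT.
have [b b1 le_b] := hb u v uI' vI'.
have cvg_b : ((fun n => u * v * b n) @ \oo --> u * v * 1)%classic.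
  by apply: cvgMr.
rewrite -[leRHS]mulr1 -(cvg_lim _ cvg_b)//.
apply: ler_lim; first exact: Tsigma_iterates_cvg.
  by apply/cvg_ex; exists (u * v * 1).
apply: nearW => n; rewrite iter_TsigmaE//.
move: uI vI; rewrite !in_itv /= => /andP[u0 _] /andP[v0 _].
apply: ler_wpM2l; first exact: mulr_ge0.
apply: le_trans (le_b n); apply: ler_piMr; last exact: damping_prod_le1.
have := copula_range hD (orbit_itvW _ _ n hf uI') (orbit_itvW _ _ n hg vI').
rewrite in_itv /= => /andP[D0 _].
by rewrite divr_ge0// mulr_ge0// ltW// orbit_gt0.
Qed.

Lemma NQD_Tsigma_lim_NQD f g D : generator f -> generator g -> copula D ->
  NQD D -> NQD (iterates_lim (Tsigma f g) D).
Proof.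
move=> hf hg hD nD; apply: Tsigma_lim_NQD => // u v uI vI.
exists (fun=> 1) => [|n]; first exact: cvg_cst.
rewrite ler_pdivrMr ?mulr_gt0 ?orbit_gt0// mul1r.
by apply: nD; rewrite orbit_itvW.
Qed.

Lemma nonzero_Tsigma_lim_NQD f g D : generator f -> generator g -> copula D ->
  {in `]0, 1[, forall x, f x != 0} \/ {in `]0, 1[, forall x, g x != 0} ->
  NQD (iterates_lim (Tsigma f g) D).
Proof.
have cvgV1 h x : generator h -> {in `]0, 1[, forall x, h x != 0} ->
    x \in `]0, 1] -> ((fun n => (orbit h x n)^-1) @ \oo --> (1 : R))%classic.
  move=> hh hN0 xI; rewrite -[X in (_ --> X)%classic]invr1.
  by apply: cvgV; [exact: oner_neq0 | exact: orbit_cvg1].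
move=> hf hg hD fgN0; apply: Tsigma_lim_NQD => // u v uI vI.
have x_gt0 n := orbit_gt0 _ _ n hf uI; have y_gt0 n := orbit_gt0 _ _ n hg vI.
case: fgN0 => hN0.
  exists (fun n => (orbit f u n)^-1) => [|n]; first exact: cvgV1.
  rewrite ler_pdivrMr ?mulr_gt0// mulKf ?gt_eqF//.
  by apply: copula_le_r; rewrite ?orbit_itvW.
exists (fun n => (orbit g v n)^-1) => [|n]; first exact: cvgV1.
rewrite ler_pdivrMr ?mulr_gt0// mulrCA mulVf ?gt_eqF// mulr1.
by apply: copula_le_l; rewrite ?orbit_itvW.
Qed.

(** * Conjugation of the maxmin transformation with the reflected one *)

Definition phi_gen phi u := phi u - u.

(** Flipping reverses the second coordinate, so [psi] has to be reflected in
    both its argument and its value before it can be of the form [fhat g]. *)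
Definition psi_gen psi w := 1 - w - psi (1 - w).

Lemma fhat_phi_gen phi u : fhat (phi_gen phi) u = phi u.
Proof. by rewrite /fhat /phi_gen; ring. Qed.

Lemma fhat_psi_gen psi w : fhat (psi_gen psi) w = 1 - psi (1 - w).
Proof. by rewrite /fhat /psi_gen; ring. Qed.

(** Since [fstar h = 1 / q - 1] for [q x = x / fhat h x], (G3) amounts to the
    monotonicity of [q].  For the maxmin transformation [q] is [phistar phi] for
    one factor and [w |-> 1 - psistar psi (1 - w)] for the other. *)
Lemma fstar_antitone h : {in `]0, 1], forall x, 0 < fhat h x} ->
  {in `]0, 1] &, {homo (fun x => x / fhat h x) : x y / x <= y}} ->
  {in `]0, 1] &, {homo fstar h : x y /~ x <= y}}.
Proof.
move=> hpos hq x y xI yI yx; have := hq y x yI xI yx.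
have [hx hy] := (hpos x xI, hpos y yI).
move: xI yI; rewrite !in_itv /= => /andP[x0 _] /andP[y0 _].
rewrite ler_pdivrMr// mulrAC ler_pdivlMr// /fstar /fhat => q_le.
rewrite ler_pdivrMr// mulrAC ler_pdivlMr//; lra.
Qed.

Lemma phi_generator phi : F1 phi -> generator (phi_gen phi).
Proof.
move=> hphi; split.
- by rewrite /phi_gen (F1_0 hphi) subr0.
- by rewrite /phi_gen (F1_1 hphi) subrr.
- by move=> x y xI yI xy; rewrite !fhat_phi_gen; apply: (F1_homo hphi).
- apply: fstar_antitone => [x xI|x y xI yI xy]; rewrite !fhat_phi_gen.
    exact: (F1_gt0 hphi).
  exact: (F1_star hphi).
Qed.

Lemma psistar_onem psi w : F2 psi -> w \in `]0, 1] ->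
  w / fhat (psi_gen psi) w = 1 - psistar psi (1 - w).
Proof.
move=> hpsi; rewrite in_itv /= => /andP[w0 w1].
have psi_lt1 : psi (1 - w) < 1.
  by apply: (F2_lt1 hpsi); rewrite in_itv /=; apply/andP; split; lra.
rewrite /psistar fhat_psi_gen ifF; last by apply/negbTE; rewrite lt_eqF//; lra.
by field; rewrite subr_eq0 gt_eqF.
Qed.

Lemma psi_generator psi : F2 psi -> generator (psi_gen psi).
Proof.
move=> hpsi; split.
- by rewrite /psi_gen subr0 (F2_1 hpsi) subrr.
- by rewrite /psi_gen subrr (F2_0 hpsi) subrr.
- move=> x y xI yI xy; rewrite !fhat_psi_gen lerD2l lerN2.
  by apply: (F2_homo hpsi); rewrite ?onem_itv// lerD2l lerN2.
- apply: fstar_antitone => [w|x y xI yI xy].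
    rewrite fhat_psi_gen in_itv /= subr_gt0 => /andP[w0 w1].
    by apply: (F2_lt1 hpsi); rewrite in_itv /=; apply/andP; split; lra.
  rewrite !psistar_onem// lerD2l lerN2; apply: (F2_star hpsi).
  + by apply: onem_itv; move: yI; rewrite !in_itv /= => /andP[/ltW -> ->].
  + by apply: onem_itv; move: xI; rewrite !in_itv /= => /andP[/ltW -> ->].
  + by rewrite lerD2l lerN2.
Qed.

Lemma iter_TmaxminE phi psi C u v n : F1 phi -> F2 psi -> copula C ->
  u \in `[0, 1] -> v \in `[0, 1] ->
  iter n (Tmaxmin phi psi) C u v
  = u - iter n (Tsigma (phi_gen phi) (psi_gen psi)) (flip C) u (1 - v).
Proof.
move=> hphi hpsi hC; elim: n u v => [|n IHn] u v uI vI.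
  by rewrite /= /flip !subKr.
have phiI := F1_range hphi uI; have psiI := F2_range hpsi vI.
rewrite !iterS {1}/Tmaxmin IHn//.
case: (eqVneq u 0) => [->|u_neq0]; first by rewrite /Tsigma eqxx subr0.
case: (eqVneq v 1) => [v1|v_neq1].
  rewrite v1 (F2_1 hpsi) subrr /Tsigma eqxx orbT iter_Tsigma0 ?eqxx ?orbT//.
  - by rewrite subr0 subrr mul0r addr0 subr0.
  - exact: flip_copula.
  - by rewrite in_itv /= lexx ler01.
rewrite /Tsigma (negbTE u_neq0) subr_eq0 eq_sym (negbTE v_neq1) /=.
rewrite fhat_phi_gen fhat_psi_gen subKr.
set d := iter n _ _ _ _.
have {}uI : u \in `]0, 1].
  by case: (unit_itv_case _ uI) => // u0; rewrite u0 eqxx in u_neq0.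
have vI' : v \in `[0, 1[.
  by move: vI; rewrite !in_itv /= lt_neqAle v_neq1 => /andP[-> ->].
have p_gt0 : 0 < phi u by exact: (F1_gt0 hphi).
have q_gt0 : 0 < 1 - psi v by rewrite subr_gt0; exact: (F2_lt1 hpsi).
have u_gt0 : 0 < u by move: uI; rewrite in_itv /= => /andP[].
have w_gt0 : 0 < 1 - v by move: vI'; rewrite in_itv /= subr_gt0 => /andP[].
(* With [w = 1 - v], [p = u + f = phi u] and [q = w + g = 1 - psi v], the
   difference is [u / p - g / q = u w (1 - (f / u) (g / w)) / (p q)], and the
   positive factor [u w / (p q)] goes through the maximum. *)
have -> : Num.max 0 (phistar phi u - psistar psi v)
    = u * (1 - v) / (phi u * (1 - psi v)) *
      Num.max 0 (1 - fstar (phi_gen phi) u * fstar (psi_gen psi) (1 - v)).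
  rewrite maxr_pMr; last first.
    by rewrite divr_ge0 ?mulr_ge0 // ltW.
  rewrite mulr0; congr Num.max.
  rewrite /phistar /psistar (negbTE v_neq1) /fstar /phi_gen /psi_gen subKr.
  by field; rewrite !gt_eqF.
set m := Num.max _ _.
by field; rewrite !gt_eqF.
Qed.

Lemma Tmaxmin_iterates_cvg phi psi C : F1 phi -> F2 psi -> copula C ->
  iterates_cvg (Tmaxmin phi psi) C.
Proof.
move=> hphi hpsi hC u v uI vI.
under eq_fun => n do rewrite iter_TmaxminE//.
apply: is_cvgB; first exact: is_cvg_cst.
apply: (Tsigma_iterates_cvg _ _ _ (phi_generator _ hphi)
  (psi_generator _ hpsi)).
- exact: flip_copula.
- exact: uI.
- exact: onem_itv.
Qed.

Lemma Tmaxmin_lim_PQD phi psi C : F1 phi -> F2 psi -> copula C ->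
  NQD (iterates_lim (Tsigma (phi_gen phi) (psi_gen psi)) (flip C)) ->
  PQD (iterates_lim (Tmaxmin phi psi) C).
Proof.
move=> hphi hpsi hC nqd u v uI vI; have wI := onem_itv _ vI.
have := nqd u (1 - v) uI wI; rewrite /iterates_lim.
under [X in _ -> _ <= lim (X @ _)%classic]eq_fun => n do
  rewrite iter_TmaxminE//.
rewrite limB; [|exact: is_cvg_cst|].
  rewrite lim_cst//; lra.
apply: (Tsigma_iterates_cvg _ _ _ (phi_generator _ hphi)
  (psi_generator _ hpsi)).
- exact: flip_copula.
- exact: uI.
- exact: wI.
Qed.

Lemma nonzero_generators phi psi :
  {in `]0, 1[, forall x, phi x != x} \/ {in `]0, 1[, forall x, psi x != x} ->
  {in `]0, 1[, forall x, phi_gen phi x != 0} \/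
  {in `]0, 1[, forall x, psi_gen psi x != 0}.
Proof.
case=> N0; [left|right] => x xI; rewrite subr_eq0; first exact: N0.
rewrite eq_sym; apply: N0; move: xI; rewrite !in_itv /= => /andP[? ?].
by apply/andP; split; lra.
Qed.

End MaxminLimits.

Theorem theorem11 (R : realType) (C : R -> R -> R) (f g phi psi : R -> R)
    (hC : copula C) (hG1 : G1 f g) (hG2 : G2 f g) (hG3 : G3 f g)
    (hphi : F1 phi) (hpsi : F2 psi) :
  let Cfg := iterates_lim (Tsigma f g) (flip C) in
  let Cphipsi := iterates_lim (Tmaxmin phi psi) C in
  (* both pointwise limits exist *)
  (iterates_cvg (Tsigma f g) (flip C) /\ iterates_cvg (Tmaxmin phi psi) C) /\
  (* (a) *)
  ((PQD C <-> NQD (flip C)) /\ (PQD C -> NQD Cfg)) /\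
  (* (b) *)
  ({in `]0, 1[, forall x, f x != 0} \/ {in `]0, 1[, forall x, g x != 0} ->
     NQD Cfg) /\
  (* (c) *)
  (PQD C -> PQD Cphipsi) /\
  (* (d) *)
  ({in `]0, 1[, forall x, phi x != x} \/ {in `]0, 1[, forall x, psi x != x} ->
     PQD Cphipsi).
Proof.
move=> Cfg Cphipsi.
have [hf hg] := generators _ _ hG1 hG2 hG3.
have hD := flip_copula _ hC.
have [hphi' hpsi'] := (phi_generator _ hphi, psi_generator _ hpsi).
split.
  by split; [exact: Tsigma_iterates_cvg | exact: Tmaxmin_iterates_cvg].
split.
  split; first exact: PQD_flip.
  by move=> /PQD_flip; exact: NQD_Tsigma_lim_NQD.
split; first exact: nonzero_Tsigma_lim_NQD.
split=> [/PQD_flip nD|N0]; apply: Tmaxmin_lim_PQD => //.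
  exact: NQD_Tsigma_lim_NQD.
by apply: nonzero_Tsigma_lim_NQD => //; exact: nonzero_generators.
Qed.
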